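(* Let $k$ be a fixed non-negative integer, $\mu_k\in\mathbb{R}$, $\nu_k>0$. The following relation holds in $\mathbb{C}$ (i.e. for the complex variable $z$): $$\Lambda_k(z)\begin{bmatrix}\mathcal{P}_{n+1}(z;\mu_k,\nu_k)&\mathcal{P}_n(z;\mu_k,\nu_k)\\-\mathcal{Q}_{n+1}(z;\mu_k,\nu_k)&-\mathcal{Q}_n(z;\mu_k,\nu_k)\end{bmatrix}=\operatorname{cof}(\mathbf{M}_k)(z)\begin{bmatrix}\mathcal{P}_{n+1}(z)&\mathcal{P}_n(z)\\-\mathcal{Q}_{n+1}(z)&-\mathcal{Q}_n(z)\end{bmatrix},$$ where $\operatorname{cof}(\cdot)$ is the cofactor matrix operator and $$\mathbf{M}_k(z)=\begin{bmatrix}\hat{\mathcal{S}}_k(z)\mathcal{P}_k(z)+\Lambda_k(z) & -\mathcal{Q}_k(z)\hat{\mathcal{S}}_k(z)\\ -\mathcal{S}_k(z)\mathcal{P}_k(z) & \Lambda_k(z)+\mathcal{S}_k(z)\mathcal{Q}_k(z)\end{bmatrix},$$ $$\hat{\mathcal{S}}_k(z)=-\mu_k\mathcal{Q}_k(z)-(\nu_k-1)\lambda_k(z-a_k)\mathcal{Q}_{k-1}(z),\qquad \mathcal{S}_k(z)=\mu_k\mathcal{P}_k(z)+(\nu_k-1)\lambda_k(z-a_k)\mathcal{P}_{k-1}(z).$$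
   Context: Let $(c_n)_{n\ge0},(\lambda_n)_{n\ge0},(a_n)_{n\ge0}$ be sequences of recurrence coefficients with $\lambda_n\neq0$ for $n\ge1$. The $R_I$ polynomials $\mathcal{P}_n$ are defined by $\mathcal{P}_{-1}=0$, $\mathcal{P}_0=1$ and $\mathcal{P}_{n+1}(z)=(z-c_n)\mathcal{P}_n(z)-\lambda_n(z-a_n)\mathcal{P}_{n-1}(z)$ for $n\ge0$, with $\mathcal{P}_n(a_n)\neq0$ for $n\ge1$. The polynomials of the second kind $\mathcal{Q}_n$ are defined by $\mathcal{Q}_0=0$, $\mathcal{Q}_1=1$ and $\mathcal{Q}_{n+1}(z)=(z-c_n)\mathcal{Q}_n(z)-\lambda_n(z-a_n)\mathcal{Q}_{n-1}(z)$ for $n\ge1$. Set $\Lambda_k(z)=\prod_{j=1}^k\lambda_j(z-a_j)$. In matrix form, $$\mathbb{F}_{n+1}:=\begin{bmatrix}\mathcal{P}_{n+1}(z)&-\mathcal{Q}_{n+1}(z)\\ \mathcal{P}_n(z)&-\mathcal{Q}_n(z)\end{bmatrix}=\mathbf{T}_n\mathbb{F}_n=\mathbf{T}_n\cdots\mathbf{T}_0,\qquad \mathbf{T}_n=\begin{bmatrix}z-c_n&-\lambda_n(z-a_n)\\1&0\end{bmatrix}.$$ Thus $\mathbb{F}_0$ is the identity matrix, i.e. $\mathcal{Q}_{-1}=-1$, and $\lambda_0(z-a_0)$ is read as $1$, as $\mathcal{Q}_1=1$ then requires. The co-modified polynomials $\mathcal{P}_n(z;\mu_k,\nu_k)$ and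 $\mathcal{Q}_n(z;\mu_k,\nu_k)$ arise by changing, at the single level $n=k$, $c_k$ into $c_k+\mu_k$ and $\lambda_k$ into $\nu_k\lambda_k$. That is, the matrix $$\mathbb{F}_{n+1}(\mu_k,\nu_k)=\begin{bmatrix}\mathcal{P}_{n+1}(z;\mu_k,\nu_k)&-\mathcal{Q}_{n+1}(z;\mu_k,\nu_k)\\ \mathcal{P}_n(z;\mu_k,\nu_k)&-\mathcal{Q}_n(z;\mu_k,\nu_k)\end{bmatrix}$$ is obtained from the product $\mathbf{T}_n\cdots\mathbf{T}_0$ by replacing the factor $\mathbf{T}_k$ by $$\mathbf{T}_k(\mu_k,\nu_k)=\begin{bmatrix}z-c_k-\mu_k&-\nu_k\lambda_k(z-a_k)\\1&0\end{bmatrix}.$$ For a $2\times2$ matrix, $\operatorname{cof}\begin{bmatrix}a&b\\c&d\end{bmatrix}=\begin{bmatrix}d&-c\\-b&a\end{bmatrix}$. *)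

(* Defs.v *)
From HB Require Import structures.
From mathcomp Require Import all_boot all_order all_algebra.
From mathcomp Require Import reals complex.

Set Implicit Arguments.
Unset Strict Implicit.
Unset Printing Implicit Defensive.

Import GRing.Theory.
Local Open Scope ring_scope.

Definition mx2 (A : Type) (x y u v : A) : 'M[A]_2 :=
  \matrix_(i, j) if i == 0 :> nat then (if j == 0 :> nat then x else y)
                 else (if j == 0 :> nat then u else v).

Definition cof (A : comNzRingType) (n : nat) (M : 'M[A]_n) : 'M[A]_n :=
  \matrix_(i, j) cofactor M i j.

Definition mxeval (A : nzRingType) (m n : nat) (M : 'M[{poly A}]_(m, n)) (z : A)
  : 'M[A]_(m, n) := map_mx (fun p : {poly A} => p.[z]) M.

(* [prec f x n] is f_{n-1}, with x in the role of f_{-1}. *)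
Definition prec (A : Type) (f : nat -> A) (x : A) (n : nat) : A :=
  if n is m.+1 then f m else x.

Section RI.

Variables (C : fieldType) (c lam a : nat -> C).

(* lambda_n (z - a_n), where lambda_0 (z - a_0) is read as 1: the values of
   lam and a at index 0 are never used. *)
Definition lfac (n : nat) : {poly C} :=
  if n is 0 then 1 else lam n *: ('X - (a n)%:P).

Fixpoint RIP (n : nat) : {poly C} :=
  if n is m.+1 then
    ('X - (c m)%:P) * RIP m - lfac m * (if m is l.+1 then RIP l else 0)
  else 1.

Fixpoint RIQ (n : nat) : {poly C} :=
  match n with
  | 0 => 0
  | m.+1 =>
    if m is l.+1 then ('X - (c m)%:P) * RIQ m - lfac m * RIQ l else 1
  end.

(* P_{n-1} and Q_{n-1}, with P_{-1} = 0 and Q_{-1} = -1. *)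
Definition RIP_prec : nat -> {poly C} := prec RIP 0.
Definition RIQ_prec : nat -> {poly C} := prec RIQ (-1).

Definition Lambda (k : nat) : {poly C} :=
  \prod_(1 <= j < k.+1) (lam j *: ('X - (a j)%:P)).

Definition Tmx (n : nat) : 'M[{poly C}]_2 :=
  mx2 ('X - (c n)%:P) (- lfac n) 1 0.

Section CoModified.

Variables (k : nat) (mu nu : C).

Definition Tmx_co : 'M[{poly C}]_2 :=
  mx2 ('X - (c k)%:P - mu%:P) (- (nu *: lfac k)) 1 0.

(* The product T_{n-1} ... T_0 in which the factor T_k, if it occurs
   (that is, if k < n), is replaced by T_k(mu, nu). *)
Fixpoint Fmx_co (n : nat) : 'M[{poly C}]_2 :=
  if n is m.+1 then (if m == k then Tmx_co else Tmx m) *m Fmx_co m else 1%:M.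

(* Read off the first row of the modified product; [Fmx_coE] below shows
   that the second row then holds the preceding pair. *)
Definition coP (n : nat) : {poly C} := Fmx_co n 0 0.
Definition coQ (n : nat) : {poly C} := - Fmx_co n 0 1.

Definition Shat : {poly C} :=
  - (mu *: RIQ k) - (nu - 1) *: lfac k * RIQ_prec k.

Definition Scal : {poly C} :=
  mu *: RIP k + (nu - 1) *: lfac k * RIP_prec k.

Definition Mmx : 'M[{poly C}]_2 :=
  mx2 (Shat * RIP k + Lambda k) (- (RIQ k * Shat))
      (- (Scal * RIP k)) (Lambda k + Scal * RIQ k).

End CoModified.

Fixpoint Fmx (n : nat) : 'M[{poly C}]_2 :=
  if n is m.+1 then Tmx m *m Fmx m else 1%:M.

End RI.

Lemma mx2P (A : Type) (M N : 'M[A]_2) :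
  M 0 0 = N 0 0 -> M 0 1 = N 0 1 -> M 1 0 = N 1 0 -> M 1 1 = N 1 1 -> M = N.
Proof.
have e0 (h : (0 < 2)%N) : Ordinal h = 0 by apply/val_inj.
have e1 (h : (1 < 2)%N) : Ordinal h = 1 by apply/val_inj.
move=> h00 h01 h10 h11; apply/matrixP.
by move=> [[|[|//]] hi] [[|[|//]] hj]; rewrite ?e0 ?e1.
Qed.

Lemma mul_mx2 (A : nzRingType) (x y u v x' y' u' v' : A) :
  mx2 x y u v *m mx2 x' y' u' v' =
  mx2 (x * x' + y * u') (x * y' + y * v') (u * x' + v * u') (u * y' + v * v').
Proof.
by apply: mx2P; rewrite !mxE !big_ord_recl big_ord0 addr0 !mxE.
Qed.

Lemma cof_mx2 (A : comNzRingType) (x y u v : A) :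
  cof (mx2 x y u v) = mx2 v (- u) (- y) x.
Proof.
by apply: mx2P; rewrite !mxE /cofactor det_mx11 !mxE /= ?expr0 ?expr1 ?expr2
  ?mulN1r ?opprK ?mul1r.
Qed.

Section CoefficientChange.

Variables (C : fieldType) (c lam a : nat -> C) (k : nat) (mu nu : C).

Let c' n := if n == k then c n + mu else c n.
Let lam' n := if n == k then nu * lam n else lam n.

(* The modified product is the effect of changing c_k and lambda_k in the
   recurrence.  For k = 0 this fails for the second kind, because
   lambda_0 (z - a_0) = 1 becomes nu and then Q_1 becomes nu. *)
Lemma coP_RIP n : coP c lam a k mu nu n = RIP c' lam' a n.
Proof.
rewrite /coP; suff [] : Fmx_co c lam a k mu nu n 0 0 = RIP c' lam' a n /\
  Fmx_co c lam a k mu nu n 1 0 = RIP_prec c' lam' a n by [].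
elim: n => [|n [IH0 IH1]]; first by rewrite !mxE.
have e10 : lift ord0 ord0 = 1 :> 'I_2 by apply/val_inj.
rewrite /= !mxE !big_ord_recl !big_ord0 !addr0 e10 IH0 IH1 /c'.
case: n {IH0 IH1} => [|n].
  by case: eqP => [<-|_]; rewrite !mxE /= ?mulr1 ?mulr0 ?subr0 ?addr0 ?mul1r
    ?polyCD ?opprD ?addrA.
rewrite /lam' /=; case: eqP => [<-|_]; rewrite !mxE /= mul1r mul0r addr0; split => //.
  by rewrite scalerA polyCD opprD addrA mulNr.
by rewrite mulNr.
Qed.

Lemma coQ_RIQ n : (0 < k)%N -> coQ c lam a k mu nu n = RIQ c' lam' a n.
Proof.
move=> k0; rewrite /coQ.
suff [-> _] : Fmx_co c lam a k mu nu n 0 1 = - RIQ c' lam' a n /\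
  Fmx_co c lam a k mu nu n 1 1 = - RIQ_prec c' lam' a n by rewrite opprK.
elim: n => [|n [IH0 IH1]]; first by rewrite !mxE /= oppr0 opprK.
have e10 : lift ord0 ord0 = 1 :> 'I_2 by apply/val_inj.
rewrite /= !mxE !big_ord_recl !big_ord0 !addr0 e10 IH0 IH1 /c'.
case: n {IH0 IH1} => [|n].
  by rewrite (ltn_eqF k0) !mxE /= ?oppr0 ?opprK ?mulr1 ?mulr0 ?mul0r ?addr0 ?add0r.
rewrite /lam' /=; case: eqP => [<-|_]; rewrite !mxE /= mul1r mul0r addr0; split => //.
  by rewrite scalerA polyCD !opprD addrA mulrN mulNr mulrN.
by rewrite opprD mulrN mulNr mulrN.
Qed.

End CoefficientChange.

Section Checks.

Variables (C : fieldType) (c lam a : nat -> C).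

(* F_n = T_{n-1} ... T_0 for every n >= 0, including F_0 = 1. *)
Lemma FmxE n :
  Fmx c lam a n =
  mx2 (RIP c lam a n) (- RIQ c lam a n) (RIP_prec c lam a n)
      (- RIQ_prec c lam a n).
Proof.
elim: n => [|[|n] IH].
- by apply: mx2P; rewrite !mxE /= ?oppr0 ?opprK.
- rewrite [LHS]/= mulmx1; apply: mx2P; rewrite !mxE //=.
  + by rewrite mulr1 mulr0 subr0.
  + by rewrite oppr0.
rewrite [LHS]/= -/(Fmx c lam a n.+1) IH mul_mx2 /=.
by apply: mx2P; rewrite !mxE //= ?mul1r ?mul0r ?addr0 ?mulNr // mulrN mulrN opprD !opprK.
Qed.

Lemma Fmx_coE k mu nu n :
  Fmx_co c lam a k mu nu n.+1 =
  mx2 (coP c lam a k mu nu n.+1) (- coQ c lam a k mu nu n.+1)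
      (coP c lam a k mu nu n) (- coQ c lam a k mu nu n).
Proof.
apply: mx2P; rewrite [RHS]mxE //= ?opprK //;
  by rewrite !mxE !big_ord_recl big_ord0; case: eqP => _; rewrite !mxE /= mul1r mul0r !addr0.
Qed.

End Checks.

(* Main.v *)
(* Write F_n = T_(n-1) ... T_0, let F'_n be the same product with T_k replaced
   by T_k(mu, nu), and put E = T_k(mu, nu) - T_k.
   Since F'_{k+1} = F_{k+1} + E F_k and det F_{k+1} = Lambda_k,
     Lambda_k F'_{k+1} = F_{k+1} (Lambda_k I + adj(F_{k+1}) E F_k),
   and the bracket is adj(M_k).  Multiplying on the left by T_n ... T_{k+1}
   and transposing gives the theorem. *)
Require Import Defs.
From mathcomp Require Import all_boot all_order all_algebra.
From mathcomp Require Import reals complex.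
From mathcomp Require Import ring.

Set Implicit Arguments.
Unset Strict Implicit.
Unset Printing Implicit Defensive.

Import GRing.Theory Num.Theory.
Local Open Scope ring_scope.
Local Open Scope complex_scope.

Lemma tr_cof (A : comNzRingType) (n : nat) (M : 'M[A]_n) : (cof M)^T = \adj M.
Proof. by apply/matrixP => i j; rewrite !mxE. Qed.

Lemma adj_mx2 (A : comNzRingType) (x y u v : A) :
  \adj (mx2 x y u v) = mx2 v (- y) (- u) x.
Proof.
by rewrite -tr_cof cof_mx2; apply: mx2P; rewrite !mxE.
Qed.

Lemma det_mx2 (A : comNzRingType) (x y u v : A) :
  \det (mx2 x y u v) = x * v - y * u.
Proof.
(* The determinant is the top left entry of the matrix times its adjugate. *)
have := congr1 (fun M : 'M_2 => M 0 0) (mul_mx_adj (mx2 x y u v)).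
by rewrite adj_mx2 mul_mx2 !mxE /= mulr1n mulrN => <-.
Qed.

(** Over a commutative ring, evaluation at [z] is a ring morphism, packaged as [horner_eval z]. *)
Lemma mxevalM (A : comNzRingType) (m n p : nat) (M : 'M[{poly A}]_(m, n))
    (N : 'M[{poly A}]_(n, p)) (z : A) :
  mxeval (M *m N) z = mxeval M z *m mxeval N z.
Proof. by rewrite -[LHS]/(map_mx (horner_eval z) _) map_mxM. Qed.

Section CoModification.

Variables (C : fieldType) (c lam a : nat -> C) (k : nat) (mu nu : C).

Local Notation F := (Fmx c lam a).
Local Notation F' := (Fmx_co c lam a k mu nu).
Local Notation M := (Mmx c lam a k mu nu).
Local Notation E := (mx2 (- mu%:P) (- ((nu - 1) *: lfac lam a k)) 0 0).

(** Each [Tmx j] has determinant [lfac j]; the convention [lfac 0 = 1] makes the product start at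
    index 1, as in [Lambda]. *)
Lemma det_Fmx n : \det (F n.+1) = Lambda lam a n.
Proof.
elim: n => [|n IH].
  by rewrite /= mulmx1 det_mx2 /Lambda big_geq //; ring.
rewrite [F _]/= -/(F n.+1) det_mulmx IH det_mx2 /Lambda [RHS]big_nat_recr //=.
by ring.
Qed.

Lemma Fmx_co_le n : (n <= k)%N -> F' n = F n.
Proof.
by elim: n => //= n IH nk; rewrite (ltn_eqF nk) IH // ltnW.
Qed.

Lemma Fmx_coS : F' k.+1 = F k.+1 + E *m F k.
Proof.
rewrite /= eqxx Fmx_co_le // -mulmxDl; congr (_ *m _).
apply: mx2P; rewrite !mxE //= ?addr0 //.
by rewrite scalerBl scale1r opprB addKr.
Qed.

(** [E *m F k] has first row [- Scal], [- Shat] and zero second row. Hence only the first column of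
    the adjugate of [F k.+1] enters, with entries [- RIQ k] and [- RIP k]; this is why [Mmx]
    involves no polynomial of index [k.+1]. *)
Lemma adj_Mmx : \adj M = (Lambda lam a k)%:M + \adj (F k.+1) *m (E *m F k).
Proof.
rewrite [F k.+1]FmxE FmxE !adj_mx2 !mul_mx2.
apply: mx2P; rewrite !mxE /= ?mulr1n ?mulr0n /Shat /Scal -!mul_polyC; ring.
Qed.

Lemma Lambda_Fmx_co n : (k < n)%N -> Lambda lam a k *: F' n = F n *m \adj M.
Proof.
elim: n => // n IH; rewrite ltnS leq_eqVlt => /predU1P[<-|kn].
  rewrite Fmx_coS adj_Mmx mulmxDr mulmxA mul_mx_adj det_Fmx.
  by rewrite mul_mx_scalar mul_scalar_mx scalerDr.
by rewrite /= (gtn_eqF kn) scalemxAr IH // mulmxA.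
Qed.

End CoModification.

Theorem theorem2p2 (R : realType) (c lam a : nat -> R[i])
  (lam_neq0 : forall n : nat, (1 <= n)%N -> lam n != 0)
  (RIP_neq0 : forall n : nat, (1 <= n)%N -> (RIP c lam a n).[a n] != 0)
  (k : nat) (mu nu : R) (nu_gt0 : 0 < nu)
  (n : nat) (le_kn : (k <= n)%N) (z : R[i]) :
  let P := RIP c lam a in
  let Q := RIQ c lam a in
  let Pco := coP c lam a k mu%:C nu%:C in
  let Qco := coQ c lam a k mu%:C nu%:C in
  (Lambda lam a k).[z] *:
    mx2 (Pco n.+1).[z] (Pco n).[z] (- (Qco n.+1).[z]) (- (Qco n).[z]) =
  mxeval (cof (Mmx c lam a k mu%:C nu%:C)) z *m
    mx2 (P n.+1).[z] (P n).[z] (- (Q n.+1).[z]) (- (Q n).[z]).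
Proof.
move=> P Q Pco Qco.
have := Lambda_Fmx_co c lam a mu%:C nu%:C (le_kn : (k < n.+1)%N).
rewrite Fmx_coE FmxE /= => /(congr1 (fun M => mxeval M^T z)).
(* Transposing reverses the product, which moves the correction factor to the left and turns [\adj]
   into [cof]. *)
rewrite trmx_mul -tr_cof trmxK.
rewrite mxevalM => H.
transitivity (mxeval
  (Lambda lam a k *: mx2 (Pco n.+1) (- Qco n.+1) (Pco n) (- Qco n))^T z).
  by apply: mx2P; rewrite !mxE /= ?hornerM ?hornerN.
rewrite H; congr (_ *m _).
by apply: mx2P; rewrite !mxE /= ?hornerN.
Qed.
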